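(* Let $X$ be a complete semitopological semilattice. Then the following conditions are equivalent: (1) the topology $w^\bullet_X$ is Hausdorff; (2) the topology $w_X$ is Hausdorff; (3) $X$ is $\mathbb I$-separated; (4) $X$ is a $V$-semilattice satisfying the separation axiom $T_1$; (5) $X$ is a $T_0$-space and $w_X=w^\bullet_X$.
   Context: A semilattice is a commutative semigroup of idempotents, ordered by $x\le y$ iff $xy=x$; ${\uparrow}x=\{y\in X:x\le y\}$, ${\downarrow}x=\{y\in X:y\le x\}$. A semitopological semilattice is a semilattice with a topology for which the operation $(x,y)\mapsto xy$ is separately continuous (no separation axiom is assumed). It is complete if each non-empty chain $C\subset X$ has an infimum and a supremum in $X$ with $\inf C\in\bar C$ and $\sup C\in\bar C$ (closure in $X$). The weak$^\bullet$ topology $w^\bullet_X$ on $X$ is generated by the subbase of complements to closed subsemilattices of $X$. The $\mathbb I$-weak topology $w_X$ is generated by the subbase of all sets $h^{-1}(U)$, where $U\subset\mathbb I$ is open and $h:X\to\mathbb I$ is a continuous semigroup homomorphism to $\mathbb I=[0,1]$ with the usual topology and operation $\min$. $X$ is $\mathbb I$-separated if for any distinct $x,y\in X$ there is a continuous semigroup homomorphism $h:X\to\mathbb I$ with $h(x)\ne h(y)$. $X$ is a $V$-semilattice if for any points $x\not\le y$ in $X$ there is a point $v\notin{\downarrow}y$ in $X$ such that ${\uparrow}v$ contains $x$ in its interior in $X$. *)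

(* Defs.v *)
From HB Require Import structures.
From mathcomp Require Import all_boot all_order all_algebra.
From mathcomp Require Import all_classical all_reals all_analysis.

Set Implicit Arguments.
Unset Strict Implicit.
Unset Printing Implicit Defensive.

Import Order.TTheory GRing.Theory Num.Theory.
Import numFieldNormedType.Exports.

Local Open Scope classical_set_scope.

HB.mixin Record Semigroup_isSemilattice T & Semigroup T := {
  slmulC : commutative (fun x y : T => (x * y)%g);
  slmulxx : idempotent_op (fun x y : T => (x * y)%g)
}.

#[short(type="semilatticeType")]
HB.structure Definition Semilattice :=
  { T of Semigroup T & Semigroup_isSemilattice T }.

(* Not an Order.MeetSemilattice: HB refuses a structure joining that class with
   Topological (its joins with the library's OrderNbhs are missing). *)
HB.mixin Record isSemitopologicalSemilattice T
    & Topological T & Semilattice T := {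
  slmull_continuous : forall a : T, continuous (fun x : T => (a * x)%g);
  slmulr_continuous : forall a : T, continuous (fun x : T => (x * a)%g)
}.

#[short(type="semitopologicalSemilatticeType")]
HB.structure Definition SemitopologicalSemilattice :=
  { T of Topological T & Semilattice T & isSemitopologicalSemilattice T }.

Section Order.
Context (X : semilatticeType).
Implicit Types (x y : X) (C : set X).

Definition sle x y : Prop := (x * y)%g = x.

Definition upset x : set X := [set y | sle x y].
Definition downset x : set X := [set y | sle y x].

Definition is_chain C := total_on C sle.

Definition is_inf C x :=
  (forall c, C c -> sle x c) /\
  (forall z, (forall c, C c -> sle z c) -> sle z x).

Definition is_sup C x :=
  (forall c, C c -> sle c x) /\
  (forall z, (forall c, C c -> sle c z) -> sle x z).

Definition is_subsemilattice C := forall x y, C x -> C y -> C (x * y)%g.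

End Order.

Section Semitopological.
Context (X : semitopologicalSemilatticeType).

Definition complete_semilattice :=
  forall C : set X, is_chain C -> C !=set0 ->
    (exists2 x, is_inf C x & closure C x) /\
    (exists2 x, is_sup C x & closure C x).

Definition V_semilattice :=
  forall x y : X, ~ sle x y ->
    exists v : X, ~ downset y v /\ interior (upset v) x.

End Semitopological.

Section WeakBullet.
Context (X : semitopologicalSemilatticeType).

Definition wbullet_subbase : set (set X) :=
  [set ~` F | F in [set F | closed F /\ is_subsemilattice F]].

Definition wbullet_topology : Type := X.

HB.instance Definition _ := Choice.on wbullet_topology.
HB.instance Definition _ :=
  isSubBaseTopological.Build wbullet_topology wbullet_subbase id.

Definition wbullet_open : set (set X) := @open wbullet_topology.

End WeakBullet.

(* A set coerces to its subtype, which carries the subspace topology. *)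
Definition unit_interval (R : realType) : Type := (`[0%R, 1%R] : set R).

HB.instance Definition _ (R : realType) := Topological.on (unit_interval R).

(* R is a parameter of the alias because the topology put on it depends on R. *)
Definition I_weak_topology (R : realType) (X : semitopologicalSemilatticeType)
  : Type := X.

Section IWeak.
Context (R : realType) (X : semitopologicalSemilatticeType).

Definition I_homomorphism (h : X -> unit_interval R) :=
  forall x y, sval (h (x * y)%g) = Num.min (sval (h x)) (sval (h y)).

Definition I_weak_subbase : set (set X) :=
  [set V | exists (h : X -> unit_interval R) (U : set (unit_interval R)),
     [/\ continuous h, I_homomorphism h, open U & V = h @^-1` U]].

HB.instance Definition _ := Choice.on (I_weak_topology R X).
HB.instance Definition _ :=
  isSubBaseTopological.Build (I_weak_topology R X) I_weak_subbase id.

Definition I_weak_open : set (set X) := @open (I_weak_topology R X).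

Definition I_separated :=
  forall x y : X, x <> y ->
    exists h : X -> unit_interval R,
      [/\ continuous h, I_homomorphism h & h x <> h y].

End IWeak.

Arguments wbullet_subbase : clear implicits.
Arguments wbullet_open : clear implicits.
Arguments I_weak_subbase : clear implicits.
Arguments I_weak_open : clear implicits.

(* Main.v *)
Require Import Defs.
From mathcomp Require Import all_boot all_order all_algebra.
From mathcomp Require Import all_classical all_reals all_analysis.

(** Everything rests on one consequence of completeness: a filtered family of
    nonempty closed subsemilattices has a common point
    ([filtered_chain_subsemilattice_meet]).  Only the order is used there, so
    it is proved for subsemilattices closed under infima and suprema of chains.

    Preimages of closed intervals under continuous homomorphisms to [0, 1] are
    closed subsemilattices, hence w_X is always coarser than the weak-bullet
    topology.  This gives at once (3) => (2) => (1), and (5) => (3) because the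
    closure of a point is a closed subsemilattice.  If X is I-separated and F
    is a closed subsemilattice missing x, the closed subsemilattices that are
    w_X-neighbourhoods of x cannot all meet F, as a common point would not be
    separated from x; so the two topologies agree ([I_separated_wbullet_open]).

    Write v << x when x is interior to the principal filter of v.

    (1) => (4), [wbullet_hausdorff_V].  If X is not a V-semilattice at x, the
    supremum z of all v << x differs from x.  Consider the filter generated by
    the sets O /\ L, where O is a neighbourhood of x and L a lower set having x
    in its closure; separate continuity makes it a proper filter.  It converges
    to x, and in the weak-bullet topology it also converges to z: if B is a
    closed subsemilattice missing z, then some trace of B on a neighbourhood
    of x has a lower bound d not below z, for otherwise B would contain a point
    below z and above every v << x, that is z itself.  As d << x fails, x is in
    the closure of the lower set of points not above d, and that lower set
    avoids B near x.  So z = x when the weak-bullet topology is Hausdorff.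

    (4) => (3), [V_I_separated].  A Urysohn construction inside the order.  The
    relation << interpolates, because x is the supremum of the directed set of
    all u << x, and a closed lower set contains the suprema of its directed
    subsets ([lower_set_directed_sup]).  So between v << x one finds a family
    indexed by the dyadic numbers of [0, 1] that increases for <<, and sending y
    to the supremum of the indices of members below y is a continuous
    homomorphism. *)

Set Implicit Arguments.
Unset Strict Implicit.
Unset Printing Implicit Defensive.

Import Order.TTheory GRing.Theory Num.Theory.
Import numFieldNormedType.Exports.

Local Open Scope classical_set_scope.

(** * Chain-complete semilattices *)

(** Zorn's lemma inside a subset, with upper bounds required only for nonempty
    chains: an infimum or supremum is available for these alone. *)
Lemma zorn_in (T : Type) (rel : T -> T -> Prop) (A : set T) :
  (forall t, rel t t) -> (forall r s t, rel r s -> rel s t -> rel r t) ->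
  (forall s t, rel s t -> rel t s -> s = t) -> A !=set0 ->
  (forall C, C `<=` A -> total_on C rel -> C !=set0 ->
    exists2 t, A t & forall s, C s -> rel s t) ->
  exists2 m, A m & forall s, A s -> rel m s -> s = m.
Proof.
move=> rxx rtrans ranti [a Aa] Achain.
pose S := {x | A x}.
pose rS (s t : S) := `[< rel (sval s) (sval t) >].
have [||||m mmax] := @Zorn S rS.
- by move=> t; exact/asboolP.
- by move=> r s t /asboolP rs /asboolP st; apply/asboolP; exact: rtrans st.
- move=> [s As] [t At] /asboolP st /asboolP ts.
  exact/eq_exist/ranti.
- move=> C Ctot; have [[c Cc]|C0] := pselect (C !=set0); last first.
    by exists (exist _ a Aa) => s Cs; case: C0; exists s.
  have [||| t At tub] := Achain [set sval s | s in C].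
  + by move=> _ [[s As] _ <-].
  + move=> _ _ [s Cs <-] [t Ct <-].
    by have [/asboolP|/asboolP] := Ctot _ _ Cs Ct; [left|right].
  + by exists (sval c); exists c.
  by exists (exist _ t At) => s Cs; apply/asboolP/tub; exists s.
- exists (sval m) => [|s As ms]; first exact: svalP.
  by rewrite -(mmax (exist _ s As)) //; exact/asboolP.
Qed.

Section SemilatticeOrder.
Context (X : semilatticeType).
Implicit Types (a b c d m x y z : X) (C D F L P S : set X).

Lemma sle_refl x : sle x x. Proof. exact: slmulxx. Qed.

Lemma sle_trans y x z : sle x y -> sle y z -> sle x z.
Proof. by rewrite /sle => xy yz; rewrite -xy -mulgA yz. Qed.

Lemma sle_anti x y : sle x y -> sle y x -> x = y.
Proof. by rewrite /sle => xy yx; rewrite -[LHS]xy slmulC. Qed.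

Lemma sle_mull x y : sle (x * y)%g x.
Proof. by rewrite /sle slmulC mulgA slmulxx. Qed.

Lemma sle_mulr x y : sle (x * y)%g y.
Proof. by rewrite slmulC; exact: sle_mull. Qed.

Lemma sle_mul z x y : sle z x -> sle z y -> sle z (x * y)%g.
Proof. by rewrite /sle => zx zy; rewrite mulgA zx zy. Qed.

(** Existence of the infimum and of the supremum is a matter for the ambient
    semilattice, so that this class of sets is stable under intersections. *)
Definition chain_closed F := forall C, C `<=` F -> is_chain C -> C !=set0 ->
  forall x, is_inf C x \/ is_sup C x -> F x.

Definition chain_subsemilattice F := is_subsemilattice F /\ chain_closed F.

Definition lower_set L := forall x y, sle x y -> L y -> L x.

Definition is_least F m := F m /\ forall y, F y -> sle m y.

Lemma chain_subsemilattice_upset v : chain_subsemilattice (upset v).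
Proof.
split=> [x y|C Cv _ [c Cc] x [[_ xmax]|[xub _]]]; first exact: sle_mul.
  by apply: xmax => d /Cv.
by apply: sle_trans (xub _ Cc); exact: Cv.
Qed.

Lemma chain_subsemilattice_downset v : chain_subsemilattice (downset v).
Proof.
split=> [x y xv _|C Cv _ [c Cc] x [[xlb _]|[_ xmin]]].
- exact: sle_trans (sle_mull _ _) xv.
- by apply: sle_trans (xlb _ Cc) _; exact: Cv.
- by apply: xmin => d /Cv.
Qed.

Lemma chain_subsemilatticeI F S : chain_subsemilattice F ->
  chain_subsemilattice S -> chain_subsemilattice (F `&` S).
Proof.
move=> [Fm Fc] [Sm Sc]; split=> [x y [Fx Sx] [Fy Sy]|C CFS Cch C0 x Cx].
  by split; [exact: Fm|exact: Sm].
by split; [apply: (Fc C)|apply: (Sc C)] => // y /CFS[].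
Qed.

Lemma chain_subsemilattice_bigcap (G : set (set X)) :
  (forall F, G F -> chain_subsemilattice F) ->
  chain_subsemilattice (\bigcap_(F in G) F).
Proof.
move=> Gc; split=> [x y xG yG F GF|C CG Cch C0 x Cx F GF].
  by apply: (Gc _ GF).1; [exact: xG|exact: yG].
by apply: (Gc _ GF).2 Cx => // y /CG; exact.
Qed.

Definition chain_complete := forall C, is_chain C -> C !=set0 ->
  (exists x, is_inf C x) /\ (exists x, is_sup C x).

Context (cX : chain_complete).

(** A minimal element exists by Zorn's lemma, and in a subsemilattice a minimal
    element is least since its product with any other member lies below it. *)
Lemma chain_subsemilattice_least F :
  chain_subsemilattice F -> F !=set0 -> exists m, is_least F m.
Proof.
move=> [Fm Fc] F0.
have [|||||m Fm' mmin] := @zorn_in X (fun x y => sle y x) F => //.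
- exact: sle_refl.
- by move=> x y z yx zy; exact: sle_trans zy yx.
- by move=> x y yx xy; exact: sle_anti.
- move=> C CF Cch C0.
  have Cch' : is_chain C by move=> s t Cs Ct; have [] := Cch s t Cs Ct; [right|left].
  have [[x xinf] _] := cX Cch' C0.
  by exists x; [apply: (Fc C) => //; left|exact: xinf.1].
- exists m; split=> // y Fy; have <- : (m * y)%g = m; last exact: sle_mulr.
  by apply: mmin; [exact: Fm|exact: sle_mull].
Qed.

(** Call a good when every member of the family meets the principal filter of
    a.  Good elements are closed under suprema of chains: for c running in a
    chain, the least elements of F above c form a chain in F, whose supremum is
    above the supremum of the c's.  A maximal good element m belongs to every F,
    because the least element of F above m is again good. *)
Lemma filtered_chain_subsemilattice_meet (G : set (set X)) : G !=set0 ->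
  (forall F, G F -> chain_subsemilattice F /\ F !=set0) ->
  (forall F S, G F -> G S -> exists2 K, G K & K `<=` F `&` S) ->
  exists x, forall F, G F -> F x.
Proof.
move=> [F0 GF0] Gc Gfilt.
have leastF F a : G F -> F `&` upset a !=set0 -> exists m, is_least (F `&` upset a) m.
  move=> GF; apply: chain_subsemilattice_least.
  by apply: chain_subsemilatticeI (chain_subsemilattice_upset a); have [] := Gc _ GF.
pose A := [set a | forall F, G F -> F `&` upset a !=set0].
have [|||||m Am mmax] := @zorn_in X (@sle X) A.
- exact: sle_refl.
- by move=> x y z xy yz; exact: sle_trans xy yz.
- exact: sle_anti.
- have [m [F0m mmin]] := chain_subsemilattice_least (Gc _ GF0).1 (Gc _ GF0).2.
  exists m => F GF; have [K GK KF] := Gfilt _ _ GF GF0.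
  by have [_ [y /KF[Fy F0y]]] := Gc _ GK; exists y; split=> //; exact: mmin.
- move=> C CA Cch C0; have [_ [s [sub smin]]] := cX Cch C0; exists s => // F GF.
  pose Y := [set y | exists2 c, C c & is_least (F `&` upset c) y].
  have YF : Y `<=` F by move=> y [c _ [[]]].
  have CY c : C c -> exists2 y, Y y & sle c y.
    move=> Cc; have [y ymin] := leastF _ _ GF (CA _ Cc _ GF).
    by exists y; [exists c|exact: ymin.1.2].
  have Ych : is_chain Y.
    move=> y y' [c Cc [[Fy cy] ymin]] [c' Cc' [[Fy' cy'] y'min]].
    have [cc'|c'c] := Cch _ _ Cc Cc'; [left|right].
      by apply: ymin; split=> //; exact: sle_trans cy'.
    by apply: y'min; split=> //; exact: sle_trans cy.
  have Y0 : Y !=set0 by have [c /CY[y Yy _]] := C0; exists y.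
  have [_ [t tsup]] := cX Ych Y0; exists t; split.
    by apply: (Gc _ GF).1.2 (or_intror tsup).
  by apply: smin => c /CY[y Yy cy]; apply: sle_trans cy _; exact: tsup.1.
- exists m => F GF; have [y [[Fy my] ymin]] := leastF _ _ GF (Am _ GF).
  have <- // : y = m; apply: mmax => // S GS.
  have [K GK KFS] := Gfilt _ _ GF GS; have [z [Kz mz]] := Am _ GK.
  by have [Fz Sz] := KFS _ Kz; exists z; split=> //; exact: ymin.
Qed.

(** Infima of arbitrary nonempty sets exist although only chains are assumed to
    have one: the least element of the generated chain-closed subsemilattice is
    the infimum.  Hence it belongs to each chain-closed subsemilattice
    containing the set. *)
Lemma inf_exists S : S !=set0 -> exists m, is_inf S m /\
  forall F, chain_subsemilattice F -> S `<=` F -> F m.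
Proof.
move=> [s Ss]; pose G := [set F | chain_subsemilattice F /\ S `<=` F].
have Gc : chain_subsemilattice (\bigcap_(F in G) F).
  by apply: chain_subsemilattice_bigcap => F [].
have [|m [mG mmin]] := chain_subsemilattice_least Gc.
  by exists s => F [_]; exact.
exists m; split; last by move=> F cF SF; exact: mG.
split=> [c Sc|z zlb]; first by apply: mmin => F [_]; exact.
by apply: (mG (upset z)); split=> //; exact: chain_subsemilattice_upset.
Qed.

Lemma bounded_sup_exists S u : (forall s, S s -> sle s u) -> exists z, is_sup S z.
Proof.
move=> Su; have [||z [zub zmin]] :=
    @chain_subsemilattice_least (\bigcap_(F in [set upset s | s in S]) F).
- apply: chain_subsemilattice_bigcap => _ [s _ <-].
  exact: chain_subsemilattice_upset.
- by exists u => _ [s Ss <-]; exact: Su.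
- exists z; split=> [s Ss|y yub]; first by apply: zub; exists s.
  by apply: zmin => _ [s Ss <-]; exact: yub.
Qed.

(** Suprema of directed sets are controlled by those of chains (Iwamura's
    lemma); for lower sets in the presence of bounded joins, Zorn's lemma avoids
    the usual induction on cardinals.  It is applied to the elements a below x
    such that a \/ d is in P for all d in D; a maximal one absorbs every d, so it
    is above x. *)
Lemma lower_set_directed_sup P D x : lower_set P ->
  (forall C, C `<=` P -> is_chain C -> C !=set0 -> forall s, is_sup C s -> P s) ->
  D `<=` P -> D !=set0 ->
  (forall d e, D d -> D e -> exists f, [/\ D f, sle d f & sle e f]) ->
  is_sup D x -> P x.
Proof.
move=> Plow Psup DP [d0 Dd0] Ddir [xub xmin].
have join_exists d a : D d -> sle a x -> exists j, is_sup [set d; a] j.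
  by move=> Dd ax; apply: (@bounded_sup_exists _ x) => _ [->|->] //; exact: xub.
pose A := [set a | sle a x /\ forall d j, D d -> is_sup [set d; a] j -> P j].
have [|||||m [mx Am] mmax] := @zorn_in X (@sle X) A.
- exact: sle_refl.
- by move=> u v w uv vw; exact: sle_trans uv vw.
- exact: sle_anti.
- exists d0; split=> [|d j Dd [_ jmin]]; first exact: xub.
  have [f [Df df d0f]] := Ddir _ _ Dd Dd0.
  by apply: (Plow _ f); [apply: jmin => _ [->|->]|exact: DP].
- move=> C CA Cch C0; have [_ [s [sub smin]]] := cX Cch C0.
  exists s => //; split=> [|d j Dd [jub jmin]]; first by apply: smin => c /CA[].
  pose Y := [set y | exists2 c, C c & is_sup [set d; c] y].
  have YP : Y `<=` P by move=> y [c Cc]; exact: (CA _ Cc).2.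
  have CY c : C c -> exists2 y, Y y & is_sup [set d; c] y.
    by move=> Cc; have [y ysup] := join_exists d c Dd (CA _ Cc).1; exists y => //; exists c.
  have Y0 : Y !=set0 by have [c /CY[y Yy _]] := C0; exists y.
  have Ych : is_chain Y.
    move=> y y' [c Cc [yub ymin]] [c' Cc' [y'ub y'min]].
    have [cc'|c'c] := Cch _ _ Cc Cc'; [left; apply: ymin|right; apply: y'min].
      by move=> _ [->|->]; [apply: y'ub; left|apply: sle_trans cc' _; apply: y'ub; right].
    by move=> _ [->|->]; [apply: yub; left|apply: sle_trans c'c _; apply: yub; right].
  have [_ [t tsup]] := cX Ych Y0; apply: (Plow _ t); last exact: Psup tsup.
  have ct c z : C c -> [set d; c] z -> sle z t.
    by move=> /CY[y Yy [yub _]] /yub zy; apply: sle_trans zy _; exact: tsup.1.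
  apply: jmin => _ [->|->]; first by have [c Cc] := C0; apply: (ct c) => //; left.
  by apply: smin => c Cc; apply: (ct c) => //; right.
- have dm d : D d -> sle d m /\ P m.
    move=> Dd; have [j [jub jmin]] := join_exists d m Dd mx.
    have jmE : j = m -> sle d m /\ P m.
      move=> jm; split; first by rewrite -jm; apply: jub; left.
      by apply: (Am d) => //; rewrite -[X in is_sup _ X]jm.
    apply: jmE.
    apply: mmax; last by apply: jub; right.
    split=> [|d' j' Dd' [_ j'min]]; first by apply: jmin => _ [->|->] //; exact: xub.
    have [f [Df df d'f]] := Ddir _ _ Dd Dd'.
    have [k [kub kmin]] := join_exists f m Df mx.
    apply: (Plow _ k); last exact: (Am f).
    have fk : sle f k by apply: kub; left.
    apply: j'min => _ [->|->]; first exact: sle_trans fk.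
    apply: jmin => _ [->|->]; first exact: sle_trans fk.
    by apply: kub; right.
  by apply: (Plow _ m) (dm _ Dd0).2; apply: xmin => d /dm[].
Qed.

End SemilatticeOrder.

(** * Closed subsemilattices and the weak-bullet topology *)

Section Semitopological.
Context (X : semitopologicalSemilatticeType).
Implicit Types (a b c d u v x y z : X) (B C D F L O P S W : set X).

(** The topological counterpart of the way-below relation of continuous
    lattices. *)
Definition way_below v x := nbhs x (upset v).

Lemma way_below_sle v x : way_below v x -> sle v x.
Proof. exact: nbhs_singleton. Qed.

Lemma way_below_sler v x y : way_below v x -> sle x y -> way_below v y.
Proof.
move=> vx xy; have xcont := @slmull_continuous X x y.
rewrite /continuous_at xy in xcont.
have : nbhs y ((fun s => x * s)%g @^-1` upset v) := xcont _ vx.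
by apply: filterS => s /sle_trans; apply; exact: sle_mulr.
Qed.

Lemma closure_mul A B y z : closure A y -> closure B z ->
  closure [set (a * b)%g | a in A & b in B] (y * z)%g.
Proof.
move=> Ay Bz O; rewrite nbhsE => -[U [oU Uyz] UO].
have [a [Aa Uaz]] :=
  Ay _ (@slmulr_continuous X z y _ (open_nbhs_nbhs (conj oU Uyz))).
have [b [Bb Uab]] :=
  Bz _ (@slmull_continuous X a z _ (open_nbhs_nbhs (conj oU Uaz))).
by exists (a * b)%g; split; [exists a => //; exists b|exact: UO].
Qed.

(** Near x = x * x, separate continuity gives a point s of L and then t of M
    with s * t near x, and s * t is in both lower sets. *)
Lemma closure_lower_setI L M x : lower_set L -> lower_set M ->
  closure L x -> closure M x -> closure (L `&` M) x.
Proof.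
move=> Ll Ml Lx Mx; have := closure_mul Lx Mx; rewrite slmulxx.
apply: closureS => _ [s Ls [t Mt <-]].
by split; [exact: Ll (sle_mull _ _) Ls|exact: Ml (sle_mulr _ _) Mt].
Qed.

Lemma subsemilattice_closure_set1 x : is_subsemilattice (closure [set x]).
Proof.
move=> y z yx zx; apply: closureS (closure_mul yx zx).
by move=> _ [_ -> [_ -> <-]]; exact: slmulxx.
Qed.

Lemma closed_upset v : accessible_space X -> closed (upset v).
Proof.
move=> /accessible_closed_set1 X1.
by apply: (@closed_comp _ _ (fun x => v * x)%g [set v]) => // x _;
  exact: slmull_continuous.
Qed.

(** Convergence for a topology given by a subbase has to be tested on the
    subbase only. *)
Lemma wbullet_cvg (G : set_system X) z : Filter G ->
  (forall B, closed B -> is_subsemilattice B -> ~ B z -> G (~` B)) ->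
  G --> (z : wbullet_topology X).
Proof.
move=> FG GB A; rewrite nbhsE => -[U [[D' D'D <-] [V D'V Vz]] UA].
have [E EB VE] := D'D _ D'V.
apply: (@filterS _ G _ V) => [t Vt|]; first by apply: UA; exists V.
rewrite -VE; apply: filter_bigI => i Ei.
have := EB _ Ei; rewrite inE => -[B [Bc Bs] Bi]; rewrite /= -Bi.
by apply: GB => // Bz; move: Vz; rewrite -VE => /(_ _ Ei); rewrite -Bi.
Qed.

Lemma wbullet_open_setC F : closed F -> is_subsemilattice F ->
  wbullet_open X (~` F).
Proof.
move=> Fc Fs; exists [set ~` F]; last by rewrite bigcup_set1.
by move=> _ ->; apply: finI_from1; exists F.
Qed.

Lemma wbullet_open_open U : wbullet_open X U -> open U.
Proof.
move=> oU; rewrite openE => x Ux.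
have /wbullet_cvg : Filter (nbhs x) by exact: nbhs_filter.
move=> /(_ x); apply; last exact: open_nbhs_nbhs.
by move=> B Bc _ Bx; apply: open_nbhs_nbhs; split=> //; exact: closed_openC.
Qed.

Section Complete.
Context (cX : complete_semilattice X).

Lemma complete_chain_complete : chain_complete X.
Proof.
by move=> C Cch C0; have [[x xi _] [y ys _]] := cX Cch C0; split; [exists x|exists y].
Qed.

Lemma closed_chain_sup P C s : closed P -> C `<=` P -> is_chain C -> C !=set0 ->
  is_sup C s -> P s.
Proof.
move=> Pc CP Cch C0 [sub smin]; have [_ [t [tub tmin] Ct]] := cX Cch C0.
by rewrite (sle_anti (smin _ tub) (tmin _ sub)); apply: Pc; exact: closureS Ct.
Qed.

Lemma closed_chain_inf P C s : closed P -> C `<=` P -> is_chain C -> C !=set0 ->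
  is_inf C s -> P s.
Proof.
move=> Pc CP Cch C0 [slb smax]; have [[t [tlb tmax] Ct] _] := cX Cch C0.
by rewrite (sle_anti (tmax _ slb) (smax _ tlb)); apply: Pc; exact: closureS Ct.
Qed.

Lemma closed_chain_subsemilattice F :
  closed F -> is_subsemilattice F -> chain_subsemilattice F.
Proof.
move=> Fc Fs; split=> // C CF Cch C0 x [] Cx.
  exact: closed_chain_inf Cx.
exact: closed_chain_sup Cx.
Qed.

Lemma wbullet_hausdorff_accessible :
  hausdorff_space (wbullet_topology X) -> accessible_space X.
Proof.
move=> /hausdorff_accessible wT1 x y /wT1[A [oA xA yA]].
by exists A; split=> //; exact: wbullet_open_open.
Qed.

(** If the V-property fails at x then z, the supremum of all v << x, is not x;
    the contradiction is a filter that converges both to x and to z. *)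
Lemma wbullet_hausdorff_V :
  hausdorff_space (wbullet_topology X) -> V_semilattice X.
Proof.
move=> wT2; have cc := complete_chain_complete.
move=> x y nxy; apply: contrapT => noV.
have below_y v : way_below v x -> sle v y.
  by move=> vx; apply: contrapT => vy; apply: noV; exists v.
have [z [zub zmin]] := bounded_sup_exists cc below_y.
have zx : sle z x by apply: zmin => v; exact: way_below_sle.
have zNx : z <> x by move=> zx'; apply: nxy; rewrite -zx'; exact: zmin.
(* The traces on lower sets accumulating at x of the neighbourhoods of x. *)
pose G := filter_from [set OL : set X * set X |
  [/\ nbhs x OL.1, lower_set OL.2 & closure OL.2 x]] (fun OL => OL.1 `&` OL.2).
have GF : ProperFilter G.
  apply: filter_from_proper; last first.
    by move=> [U L] [/= Ux _ Lx]; have [t [Lt Ut]] := Lx _ Ux; exists t.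
  apply: filter_from_filter.
    by exists (setT, setT); split=> //=; [exact: filterT|exact: subset_closure].
  move=> [U L] [U' L'] [/= Ux Ll Lx] [/= U'x L'l L'x].
  exists (U `&` U', L `&` L'); last by move=> t [/= [? ?] [? ?]].
  split=> /=; [exact: filterI| |exact: closure_lower_setI].
  by move=> s t st [Lt L't]; split; [exact: Ll st Lt|exact: L'l st L't].
suff /zNx : z = x by [].
apply: (cvg_unique wT2 (F := G)).
  apply: wbullet_cvg => B Bc Bs Bz.
  suff [d [U [dz Ux UB]]] :
      exists d U, [/\ ~ sle d z, nbhs x U & U `&` B `<=` upset d].
    exists (U, ~` upset d) => [|t [/= Ut dt] Bt]; last by apply: dt; exact: UB.
    split=> //= [s t st ds dt|N Nx]; first by apply: ds; exact: sle_trans dt st.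
    apply: contrapT => Nd; apply: dz; apply: zub; apply: filterS Nx => t Nt.
    by apply: contrapT => dt; apply: Nd; exists t.
  apply: contrapT => noO.
  have Bcs := closed_chain_subsemilattice Bc Bs.
  have dz d U : nbhs x U -> U `&` B `<=` upset d -> sle d z.
    by move=> Ux UB; apply: contrapT => ndz; apply: noO; exists d, U.
  have Bx : B x.
    apply: contrapT => Bx; case: noO; exists x, (~` B); split.
    - by move=> xz; apply: zNx; exact: sle_anti.
    - by apply: open_nbhs_nbhs; split=> //; exact: closed_openC.
    - by move=> t [].
  have infO U : nbhs x U -> exists d, is_inf (U `&` B) d /\ B d.
    move=> Ux; have [|d [dinf dB]] := inf_exists cc (S := U `&` B).
      by exists x; split=> //; exact: nbhs_singleton.
    by exists d; split=> //; apply: dB => // t [].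
  (* A common point of these sets lies in B, below z, and above every v << x,
     since v bounds the trace of B on the principal filter of v; so it is z. *)
  pose H := [set F | exists d, [/\ F = (upset d `&` B) `&` downset z
     & exists2 U, nbhs x U & U `&` B `<=` upset d]].
  have Hne d U : nbhs x U -> U `&` B `<=` upset d ->
      (upset d `&` B) `&` downset z !=set0.
    move=> Ux UB; have [e [[elb emax] Be]] := infO _ Ux.
    exists e; split; last by apply: (dz _ _ Ux) => t; exact: elb.
    by split=> //; apply: emax => t; exact: UB.
  have [|||q qH] := filtered_chain_subsemilattice_meet cc (G := H).
  - have [e [[elb emax] Be]] := infO _ filterT.
    exists ((upset e `&` B) `&` downset z), e; split=> //.
    by exists setT => //; exact: filterT.
  - move=> _ [d [-> [U Ux UB]]]; split; last exact: Hne UB.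
    apply: chain_subsemilatticeI (chain_subsemilattice_downset z).
    by apply: chain_subsemilatticeI Bcs; exact: chain_subsemilattice_upset.
  - move=> _ _ [d [-> [U Ux UB]]] [d' [-> [U' U'x UB']]].
    have [e [[elb emax] Be]] := infO _ (filterI Ux U'x).
    have de : sle d e by apply: emax => t [[Ut _] Bt]; exact: UB.
    have d'e : sle d' e by apply: emax => t [[_ Ut] Bt]; exact: UB'.
    exists ((upset e `&` B) `&` downset z).
      by exists e; split=> //; exists (U `&` U'); [exact: filterI|exact: elb].
    by move=> t [[et Bt] tz]; do !split=> //;
      [exact: sle_trans de et|exact: sle_trans d'e et].
  - have qH' d U : nbhs x U -> U `&` B `<=` upset d ->
        ((upset d `&` B) `&` downset z) q.
      by move=> Ux UB; apply: qH; exists d; split=> //; exists U.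
    have [e [[elb _] _]] := infO _ filterT.
    have [[_ Bq] qz] := qH' e _ filterT elb.
    apply: Bz; suff -> : z = q by [].
    apply: sle_anti => //; apply: zmin => v vx.
    by have [[]] := qH' v _ vx (@subIsetl _ _ _).
apply: wbullet_cvg => B Bc Bs Bx; exists (~` B, setT) => [|t []//].
split=> //=; last exact: subset_closure.
by apply: open_nbhs_nbhs; split=> //; exact: closed_openC.
Qed.

(** If nothing lies between v and x, the directed set of all u << x stays in the
    closed lower set complementary to the interior of the filter of v, and so
    does its supremum, which is x by the V-property. *)
Lemma way_below_interpolate v x : accessible_space X -> V_semilattice X ->
  way_below v x -> exists u, way_below v u /\ way_below u x.
Proof.
move=> X1 XV vx; apply: contrapT => nou; have cc := complete_chain_complete.
have supx : is_sup [set u | way_below u x] x.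
  split=> [u|y yub]; first exact: way_below_sle.
  by apply: contrapT => /XV[u [uy ux]]; apply: uy; exact: yub.
suff : (~` (upset v)°) x by [].
have Pc : closed (~` (upset v)°) by apply: open_closedC; exact: open_interior.
apply: (lower_set_directed_sup cc _ _ _ _ _ supx).
- by move=> s t st nvt vs; apply: nvt; exact: way_below_sler vs st.
- by move=> C CP Cch C0 s; exact: closed_chain_sup.
- by move=> u ux vu; apply: nou; exists u.
- by exists v.
- move=> d e dx ex.
  have [||m [[dm em] mmin]] :=
      chain_subsemilattice_least cc (F := upset d `&` upset e).
  + by apply: chain_subsemilatticeI; exact: chain_subsemilattice_upset.
  + by exists x; split; exact: way_below_sle.
  + exists m; split=> //; apply: filterS (filterI dx ex) => t; exact: mmin.
Qed.

End Complete.
End Semitopological.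

(** * The topology of continuous homomorphisms to the unit interval *)

Local Open Scope ring_scope.

Section IWeak.
Context (R : realType) (X : semitopologicalSemilatticeType).
Implicit Types (h : X -> unit_interval R) (x y z : X).

Lemma I_weak_cvg (G : set_system X) z : Filter G ->
  (forall h U, continuous h -> I_homomorphism h -> open U -> U (h z) ->
    G (h @^-1` U)) ->
  G --> (z : I_weak_topology R X).
Proof.
move=> FG Gh A; rewrite nbhsE => -[U [[D' D'D <-] [V D'V Vz]] UA].
have [E EB VE] := D'D _ D'V.
apply: (@filterS _ G _ V) => [t Vt|]; first by apply: UA; exists V.
rewrite -VE; apply: filter_bigI => i Ei.
have := EB _ Ei; rewrite inE => -[h [W [hc hm oW ihW]]]; rewrite /= ihW.
by apply: Gh => //; move: Vz; rewrite -VE => /(_ _ Ei); rewrite /= ihW.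
Qed.

Lemma I_weak_open_preimage h U : continuous h -> I_homomorphism h -> open U ->
  I_weak_open R X (h @^-1` U).
Proof.
move=> hc hm oU; exists [set h @^-1` U]; last by rewrite bigcup_set1.
by move=> _ ->; apply: finI_from1; exists h, U.
Qed.

Lemma unit_interval_sval_continuous :
  continuous (fun u : unit_interval R => sval u : R).
Proof. exact: initial_continuous. Qed.

Lemma I_weak_nbhs_gt h x t : continuous h -> I_homomorphism h ->
  t < sval (h x) -> nbhs (x : I_weak_topology R X) [set y | t < sval (h y)].
Proof.
move=> hc hm tx; apply: (@open_nbhs_nbhs (I_weak_topology R X)); split=> //.
apply: (I_weak_open_preimage (U := [set u | t < sval u])) => //.
by have /continuousP/(_ _ (@open_gt R t)) := unit_interval_sval_continuous.
Qed.

Lemma I_weak_nbhs_lt h x t : continuous h -> I_homomorphism h ->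
  sval (h x) < t -> nbhs (x : I_weak_topology R X) [set y | sval (h y) < t].
Proof.
move=> hc hm tx; apply: (@open_nbhs_nbhs (I_weak_topology R X)); split=> //.
apply: (I_weak_open_preimage (U := [set u | sval u < t])) => //.
by have /continuousP/(_ _ (@open_lt R t)) := unit_interval_sval_continuous.
Qed.

Lemma closed_I_ge h t : continuous h -> closed [set y | t <= sval (h y)].
Proof.
move=> hc; apply: (closed_comp (f := fun y => sval (h y)) (D := [set s | t <= s])).
  move=> y _; apply: (@continuous_comp _ _ _ h (fun u => sval u)).
    exact: hc.
  exact: unit_interval_sval_continuous.
exact: closed_ge.
Qed.

Lemma closed_I_le h t : continuous h -> closed [set y | sval (h y) <= t].
Proof.
move=> hc; apply: (closed_comp (f := fun y => sval (h y)) (D := [set s | s <= t])).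
  move=> y _; apply: (@continuous_comp _ _ _ h (fun u => sval u)).
    exact: hc.
  exact: unit_interval_sval_continuous.
exact: closed_le.
Qed.

Lemma is_subsemilattice_I_ge h t : I_homomorphism h ->
  is_subsemilattice [set y | t <= sval (h y)].
Proof. by move=> hm x y /= tx ty; rewrite hm le_min tx. Qed.

Lemma is_subsemilattice_I_le h t : I_homomorphism h ->
  is_subsemilattice [set y | sval (h y) <= t].
Proof. by move=> hm x y /= xt yt; rewrite hm ge_min xt. Qed.

(** An open set contains, near h x, an interval whose two rays have preimages
    complementary to closed subsemilattices. *)
Lemma wbullet_nbhs_I h x U : continuous h -> I_homomorphism h ->
  open U -> U (h x) -> nbhs (x : wbullet_topology X) (h @^-1` U).
Proof.
move=> hc hm [W oW WU] Uhx.
have : nbhs (sval (h x)) W.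
  by apply: open_nbhs_nbhs; split=> //; move: Uhx; rewrite -WU.
move=> /nbhs_ballP[e /= e0 eW].
have ge_nbhs : nbhs (x : wbullet_topology X)
    (~` [set y | sval (h y) <= sval (h x) - e]).
  apply: (@open_nbhs_nbhs (wbullet_topology X)); split.
    by apply: wbullet_open_setC; [exact: closed_I_le|exact: is_subsemilattice_I_le].
  by apply/negP; rewrite -ltNge ltrBlDr ltrDl.
have le_nbhs : nbhs (x : wbullet_topology X)
    (~` [set y | sval (h x) + e <= sval (h y)]).
  apply: (@open_nbhs_nbhs (wbullet_topology X)); split.
    by apply: wbullet_open_setC; [exact: closed_I_ge|exact: is_subsemilattice_I_ge].
  by apply/negP; rewrite -ltNge ltrDl.
apply: filterS (filterI ge_nbhs le_nbhs) => y [/negP + /negP].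
rewrite -!ltNge => hxy hyx; rewrite -WU; apply: eW.
by rewrite /ball/= distrC ltr_distl hxy.
Qed.

Lemma I_weak_open_wbullet_open U : I_weak_open R X U -> wbullet_open X U.
Proof.
move=> oU; rewrite /wbullet_open openE => x Ux.
apply: (I_weak_cvg (G := nbhs (x : wbullet_topology X)) (z := x)).
  by move=> h V hc hm oV Vx; exact: wbullet_nbhs_I.
exact: open_nbhs_nbhs.
Qed.

Lemma I_weak_hausdorff_wbullet :
  hausdorff_space (I_weak_topology R X) -> hausdorff_space (wbullet_topology X).
Proof.
rewrite !open_hausdorff => IT2 x y /IT2[[A B] /= AB [oA oB disj]].
by exists (A, B) => //; split=> //; exact: I_weak_open_wbullet_open.
Qed.

Lemma I_separated_lt x y : I_separated R X -> x <> y ->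
  exists h, [/\ continuous h, I_homomorphism h &
    sval (h x) < sval (h y) \/ sval (h y) < sval (h x)].
Proof.
move=> sep /sep[h [hc hm hxy]]; exists h; split=> //.
case: (ltgtP (sval (h x)) (sval (h y))) => [| |heq]; [by left|by right|].
by case: hxy; exact: val_inj.
Qed.

Lemma I_separated_hausdorff :
  I_separated R X -> hausdorff_space (I_weak_topology R X).
Proof.
move=> sep x y xy; apply: contrapT => /(I_separated_lt sep)[h [hc hm hxy]].
have mid : exists t (b : bool), if b then sval (h x) < t < sval (h y)
                            else sval (h y) < t < sval (h x).
  by case: hxy => lt; [exists ((sval (h x) + sval (h y)) / 2), true|
    exists ((sval (h y) + sval (h x)) / 2), false]; rewrite /= !midf_lt.
have [t [[] /andP[t1 t2]]] := mid.
- have [z [/= zt tz]] :=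
    xy _ _ (I_weak_nbhs_lt hc hm t1) (I_weak_nbhs_gt hc hm t2).
  by have := lt_trans zt tz; rewrite ltxx.
- have [z [/= zt tz]] :=
    xy _ _ (I_weak_nbhs_gt hc hm t2) (I_weak_nbhs_lt hc hm t1).
  by have := lt_trans zt tz; rewrite ltxx.
Qed.

(** If no h distinguishes x from y, every w_X-neighbourhood of x contains y; but
    in a T0 space one of x and y is outside the closure of the other, which is a
    closed subsemilattice. *)
Lemma I_weak_wbullet_separated : kolmogorov_space X ->
  I_weak_open R X = wbullet_open X -> I_separated R X.
Proof.
move=> T0 weq.
have sep x y : ~ closure [set y] x -> exists h : X -> unit_interval R,
    [/\ continuous h, I_homomorphism h & h x <> h y].
  move=> yx; apply: contrapT => nosep.
  have : I_weak_open R X (~` closure [set y]).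
    rewrite weq; apply: wbullet_open_setC; first exact: closed_closure.
    exact: subsemilattice_closure_set1.
  move=> oy.
  have ycvg : principal_filter y --> (x : I_weak_topology R X).
    apply: I_weak_cvg => h U hc hm oU Ux; apply/principal_filterP.
    rewrite /preimage/=; suff <- : h x = h y by [].
    by apply: contrapT => hxy; apply: nosep; exists h.
  have /ycvg/principal_filterP : nbhs (x : I_weak_topology R X) (~` closure [set y]).
    exact: (@open_nbhs_nbhs (I_weak_topology R X)).
  by apply; exact: subset_closure.
move=> x y /eqP /T0[A [[]|[]]]; rewrite !inE => Ax Ay.
- by apply: sep => /(_ _ Ax)[_ [-> /Ay]].
- have [|h [hc hm hyx]] := sep y x; last by exists h; split=> // hxy; apply: hyx.
  by move=> /(_ _ Ax)[_ [-> /Ay]].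
Qed.

(** Compactness of the weak-bullet topology in disguise: the closed
    subsemilattices that are w_X-neighbourhoods of x have only x in common, so
    one of them avoids a given closed subsemilattice missing x. *)
Lemma I_separated_wbullet_open : complete_semilattice X -> I_separated R X ->
  I_weak_open R X = wbullet_open X.
Proof.
move=> cX sep; apply/seteqP; split=> U; first exact: I_weak_open_wbullet_open.
move=> oU; rewrite /I_weak_open openE => x Ux.
apply: (wbullet_cvg (G := nbhs (x : I_weak_topology R X)) (z := x)); last first.
  exact: open_nbhs_nbhs.
move=> B Bc Bs Bx; apply: contrapT => nB.
have cc := complete_chain_complete cX.
pose N := [set S | [/\ closed S, is_subsemilattice S &
  nbhs (x : I_weak_topology R X) S]].
have NT : N setT.
  split; [exact: closedT|by []|].
  exact: (@filterT _ (nbhs (x : I_weak_topology R X))).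
have NB S : nbhs (x : I_weak_topology R X) S -> S `&` B !=set0.
  move=> Sx; apply: contrapT => SB; apply: nB; apply: filterS Sx => t St Bt.
  by apply: SB; exists t.
have [|||q qN] := filtered_chain_subsemilattice_meet cc
    (G := [set S `&` B | S in N]).
- by exists (setT `&` B), setT.
- move=> _ [S [Sc Ss Sx] <-]; split; last exact: NB.
  by apply: chain_subsemilatticeI; exact: closed_chain_subsemilattice.
- move=> _ _ [S [Sc Ss Sx] <-] [S' [S'c S's S'x] <-].
  exists ((S `&` S') `&` B); last by move=> t [[]].
  exists (S `&` S') => //; split; first exact: closedI.
    by move=> s t [? ?] [? ?]; split; [exact: Ss|exact: S's].
  exact: (@filterI _ (nbhs (x : I_weak_topology R X))).
have Bq : B q by have [] : (setT `&` B) q by apply: qN; exists setT.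
have [|h [hc hm hxy]] := I_separated_lt (x := x) (y := q) sep.
  by move=> xq; apply: Bx; rewrite xq.
case: hxy => lt.
- have [t1 t2] := (midf_lt lt).
  have [/=] : ([set y | sval (h y) <= (sval (h x) + sval (h q)) / 2] `&` B) q.
    apply: qN; exists [set y | sval (h y) <= (sval (h x) + sval (h q)) / 2] => //.
    split; [exact: closed_I_le|exact: is_subsemilattice_I_le|].
    by apply: filterS (I_weak_nbhs_lt hc hm t1) => y; exact: ltW.
  by rewrite leNgt t2.
- have [t1 t2] := (midf_lt lt).
  have [/=] : ([set y | (sval (h q) + sval (h x)) / 2 <= sval (h y)] `&` B) q.
    apply: qN; exists [set y | (sval (h q) + sval (h x)) / 2 <= sval (h y)] => //.
    split; [exact: closed_I_ge|exact: is_subsemilattice_I_ge|].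
    by apply: filterS (I_weak_nbhs_gt hc hm t2) => y; exact: ltW.
  by rewrite leNgt t1.
Qed.

End IWeak.

(** * Urysohn functions along the order *)

(** f n k is the element attached to the dyadic number k / 2 ^ n; level n.+1
    repeats level n at even indices and interpolates at odd ones. *)
Lemma dyadic_chain (T : Type) (rel : T -> T -> Prop) a b :
  (forall r s t, rel r s -> rel s t -> rel r t) ->
  (forall r t, rel r t -> exists s, rel r s /\ rel s t) -> rel a b ->
  exists f : nat -> nat -> T, [/\ f 0 0 = a, f 0 1 = b &
    forall n k m l, (k * 2 ^ m < l * 2 ^ n)%N -> (l <= 2 ^ m)%N ->
      rel (f n k) (f m l)].
Proof.
move=> rtrans rinterp ab.
have [|g gP] := @choice (T * T)%type T
    (fun p c => rel p.1 p.2 -> rel p.1 c /\ rel c p.2).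
  move=> p; have [/rinterp[c pc]|np] := pselect (rel p.1 p.2).
    by exists c.
  by exists p.1.
pose f := fix f (n k : nat) : T := if n is n'.+1 then
    if odd k then g (f n' k./2, f n' k./2.+1) else f n' k./2
  else if k == 0 then a else b.
have f_refine n m k : f (n + m)%N (k * 2 ^ m)%N = f n k.
  elim: m => [|m IH]; first by rewrite addn0 expn0 muln1.
  rewrite addnS expnS mulnCA mul2n /= odd_double doubleK; exact: IH.
have f_succ n k : (k < 2 ^ n)%N -> rel (f n k) (f n k.+1).
  elim: n k => [[]//|n IH] k kn.
  have k2n : (k./2 < 2 ^ n)%N by rewrite ltn_half_double -mul2n -expnS.
  have [r1 r2] := gP (f n k./2, f n k./2.+1) (IH _ k2n).
  by move: r1 r2; rewrite /= uphalf_half; case: (odd k).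
have f_mono n k l : (k < l -> l <= 2 ^ n -> rel (f n k) (f n l))%N.
  elim: l => // l IH; rewrite ltnS leq_eqVlt => /orP[/eqP ->|kl] ln.
    exact: f_succ.
  by apply: rtrans (IH kl (ltnW ln)) _; exact: f_succ.
exists f; split=> // n k m l kl lm.
rewrite -(f_refine n m k) -(f_refine m n l) (addnC m); apply: f_mono => //.
by rewrite addnC expnD leq_mul2r lm orbT.
Qed.

Lemma dyadic_between (R : realType) (s t : R) : 0 <= s -> s < t ->
  exists m l, s < l%:R / 2 ^+ m < t.
Proof.
move=> s0 st; have st0 : 0 < t - s by rewrite subr_gt0.
have [m _ /(_ m (leqnn m)) mst] := near_infty_natSinv_expn_lt (PosNum st0).
exists m, (Num.truncn (s * 2 ^+ m)).+1.
have p2 : 0 < 2 ^+ m :> R by rewrite exprn_gt0.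
have /andP[l1 l2] := truncn_itv (mulr_ge0 s0 (ltW p2)).
rewrite ltr_pdivlMr// l2 /= ltr_pdivrMr// -natr1.
apply: (@le_lt_trans _ _ (s * 2 ^+ m + 1)); first by rewrite lerD2r.
by rewrite -ltrBrDl -mulrBl -ltr_pdivrMr.
Qed.

Section DyadicHeight.
Context (R : realType) (X : semitopologicalSemilatticeType).
Context (X1 : accessible_space X) (f : nat -> nat -> X).
Context (f_mono : forall n k m l, (k * 2 ^ m < l * 2 ^ n)%N -> (l <= 2 ^ m)%N ->
  way_below (f n k) (f m l)).
Implicit Types (x y : X) (r s t : R).

(** 0 is included to make the set nonempty when no member of the family is
    below x. *)
Definition dyadic_heights x : set R := [set r | r = 0 \/
  exists n k, [/\ (k <= 2 ^ n)%N, sle (f n k) x & r = k%:R / 2 ^+ n]].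

Definition dyadic_height x : R := sup (dyadic_heights x).

Lemma pow2_gt0 n : 0 < 2 ^+ n :> R. Proof. by rewrite exprn_gt0. Qed.

Lemma dyadic_ltr n k m l :
  (k%:R / 2 ^+ n < l%:R / 2 ^+ m :> R) = (k * 2 ^ m < l * 2 ^ n)%N.
Proof.
rewrite ltr_pdivrMr ?pow2_gt0// mulrAC ltr_pdivlMr ?pow2_gt0//.
by rewrite -!natrX -!natrM ltr_nat.
Qed.

Lemma dyadic_ler1 n k : (k%:R / 2 ^+ n <= 1 :> R) = (k <= 2 ^ n)%N.
Proof. by rewrite ler_pdivrMr ?pow2_gt0// mul1r -natrX ler_nat. Qed.

Lemma dyadic_heights_ub1 x : ubound (dyadic_heights x) 1.
Proof. by move=> _ [->//|[n [k [kn _ ->]]]]; rewrite dyadic_ler1. Qed.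

Lemma dyadic_height_ub x r : dyadic_heights x r -> r <= dyadic_height x.
Proof. by apply: ub_le_sup; exists 1; exact: dyadic_heights_ub1. Qed.

Lemma dyadic_height_ge0 x : 0 <= dyadic_height x.
Proof. by apply: dyadic_height_ub; left. Qed.

Lemma dyadic_height_le1 x : dyadic_height x <= 1.
Proof. by apply: ge_sup; [exists 0; left|exact: dyadic_heights_ub1]. Qed.

Lemma dyadic_height_ge n k x : (k <= 2 ^ n)%N -> sle (f n k) x ->
  k%:R / 2 ^+ n <= dyadic_height x.
Proof. by move=> kn kx; apply: dyadic_height_ub; right; exists n, k. Qed.

Lemma dyadic_height_gt t x : 0 <= t -> t < dyadic_height x ->
  exists n k, [/\ (k <= 2 ^ n)%N, sle (f n k) x & t < k%:R / 2 ^+ n].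
Proof.
move=> t0 /sup_gt[|r [->|[n [k [kn kx ->]]]] tr]; first by exists 0; left.
  by move: tr; rewrite ltNge t0.
by exists n, k.
Qed.

Lemma dyadic_height_le m l x : ~ sle (f m l) x -> dyadic_height x <= l%:R / 2 ^+ m.
Proof.
move=> lx; rewrite leNgt; apply/negP => /dyadic_height_gt[|n [k [kn kx]]].
  by rewrite divr_ge0 ?ler0n// ltW ?pow2_gt0.
rewrite dyadic_ltr => lk; apply: lx.
by apply: sle_trans (way_below_sle (f_mono lk kn)) kx.
Qed.

Lemma dyadic_height_sle x y : sle x y -> dyadic_height x <= dyadic_height y.
Proof.
move=> xy; apply: ge_sup; first by exists 0; left.
move=> _ [->|[n [k [kn kx ->]]]]; first exact: dyadic_height_ge0.
by apply: dyadic_height_ge => //; exact: sle_trans xy.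
Qed.

(** A dyadic number strictly below both heights indexes a member of the family
    that is below both x and y, hence below their product. *)
Lemma dyadic_height_mul x y :
  dyadic_height (x * y)%g = Num.min (dyadic_height x) (dyadic_height y).
Proof.
apply/eqP; rewrite eq_le le_min.
rewrite (dyadic_height_sle (sle_mull x y)) (dyadic_height_sle (sle_mulr x y)) /=.
rewrite leNgt; apply/negP => /(dyadic_between (dyadic_height_ge0 _)).
move=> [m [l /andP[]]]; rewrite lt_min => + /andP[lx ly].
rewrite ltNge dyadic_height_ge// -?dyadic_ler1.
  by apply/ltW/(lt_le_trans lx); exact: dyadic_height_le1.
by apply: sle_mul; apply: contrapT => /dyadic_height_le; rewrite leNgt ?lx ?ly.
Qed.

(** The height exceeds a dyadic number near x because f increases for <<, and
    stays below one near x because principal filters are closed. *)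
Lemma dyadic_height_continuous : continuous dyadic_height.
Proof.
move=> x; apply/cvgrPdist_lt => e e0.
have lower : \forall y \near x, dyadic_height x - e < dyadic_height y.
  have [te|te] := ltP (dyadic_height x - e) 0.
    by near=> y; apply: lt_le_trans te (dyadic_height_ge0 _).
  have /(dyadic_between te)[m [l /andP[lm ml]]] : dyadic_height x - e < dyadic_height x.
    by rewrite ltrBlDr ltrDl.
  have l0 := le_trans te (ltW lm).
  have [n [k [kn kx lk]]] := dyadic_height_gt l0 ml.
  have lk' := lk; rewrite dyadic_ltr in lk'.
  have := way_below_sler (f_mono lk' kn) kx.
  rewrite /way_below; apply: filterS => y ly; apply: lt_le_trans lm _.
  apply: dyadic_height_ge => //.
  by rewrite -dyadic_ler1 (le_trans (ltW lk))// dyadic_ler1.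
have upper : \forall y \near x, dyadic_height y < dyadic_height x + e.
  have /(dyadic_between (dyadic_height_ge0 x))[m [l /andP[lm ml]]] :
    dyadic_height x < dyadic_height x + e by rewrite ltrDl.
  have [l2|l2] := ltnP (2 ^ m) l.
    near=> y; apply: le_lt_trans (dyadic_height_le1 y) _; apply: lt_trans ml.
    by rewrite ltNge dyadic_ler1 -ltnNge.
  have xl : ~ sle (f m l) x.
    by move=> lx; move: lm; rewrite ltNge dyadic_height_ge.
  have : nbhs x (~` upset (f m l)).
    by apply: open_nbhs_nbhs; split=> //; apply: closed_openC; exact: closed_upset.
  by apply: filterS => y ly; apply: le_lt_trans ml; exact: dyadic_height_le.
near=> y; rewrite ltr_distlC; apply/andP; split; near: y; [exact: lower|exact: upper].
Unshelve. all: by end_near. Qed.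

Lemma dyadic_height_in_itv x : dyadic_height x \in (`[0, 1]%classic : set R).
Proof.
by rewrite inE /= in_itv /= dyadic_height_ge0 dyadic_height_le1.
Qed.

Definition dyadic_I_height x : unit_interval R := 
  exist (fun r : R => r \in (`[0, 1]%classic : set R)) _ (dyadic_height_in_itv x).

Lemma dyadic_I_height_continuous : continuous dyadic_I_height.
Proof. by apply: continuous_comp_initial; exact: dyadic_height_continuous. Qed.

Lemma dyadic_height1 x : sle (f 0 1) x -> dyadic_height x = 1.
Proof.
move=> x1; apply: le_anti; rewrite dyadic_height_le1 /=.
by have := @dyadic_height_ge 0 1 x isT x1; rewrite expr0 divr1.
Qed.

Lemma dyadic_height0 x : ~ sle (f 0 0) x -> dyadic_height x = 0.
Proof.
move=> x0; apply: le_anti; rewrite dyadic_height_ge0 andbT.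
by have := dyadic_height_le x0; rewrite mul0r.
Qed.

End DyadicHeight.

(** * Equivalence of the five conditions *)

Lemma V_I_separated (R : realType) (X : semitopologicalSemilatticeType) :
  complete_semilattice X -> V_semilattice X -> accessible_space X ->
  I_separated R X.
Proof.
move=> cX XV X1.
have sep x y : ~ sle x y -> exists h : X -> unit_interval R,
    [/\ continuous h, I_homomorphism h & h x <> h y].
  move=> /XV[v [vy vx]].
  have [||f [f0 f1 f_mono]] := dyadic_chain _ _ (vx : way_below v x).
  - by move=> r s t rs st; exact: way_below_sler rs (way_below_sle st).
  - by move=> r t; exact: way_below_interpolate.
  exists (dyadic_I_height R f); split.
  - exact: dyadic_I_height_continuous.
  - by move=> s t; exact: dyadic_height_mul.
  - move=> /(congr1 sval) /=; rewrite dyadic_height1 ?f1; last exact: sle_refl.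
    by rewrite (dyadic_height0 R f_mono) ?f0//; apply/eqP; exact: oner_neq0.
move=> x y xy; have [xley|] := pselect (sle x y); last exact: sep.
have [|h [hc hm hyx]] := sep y x; first by move=> yx; apply: xy; exact: sle_anti.
by exists h; split=> // hxy; apply: hyx.
Qed.

Theorem theorem7p3 (R : realType)
    (X : semitopologicalSemilatticeType) (cX : complete_semilattice X) :
  [<-> hausdorff_space (wbullet_topology X);
       hausdorff_space (I_weak_topology R X);
       I_separated R X;
       V_semilattice X /\ accessible_space X;
       kolmogorov_space X /\ I_weak_open R X = wbullet_open X].
Proof.
have sep_of_wbullet : hausdorff_space (wbullet_topology X) -> I_separated R X.
  move=> wT2; apply: V_I_separated => //; first exact: wbullet_hausdorff_V.
  exact: wbullet_hausdorff_accessible.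
split; [|split; [|split; [|split]]].
- by move=> /sep_of_wbullet; exact: I_separated_hausdorff.
- by move=> /I_weak_hausdorff_wbullet.
- move=> /I_separated_hausdorff/I_weak_hausdorff_wbullet wT2.
  by split; [exact: wbullet_hausdorff_V|exact: wbullet_hausdorff_accessible].
- move=> [XV X1]; split; first exact: accessible_kolmogorov.
  by apply: I_separated_wbullet_open => //; exact: V_I_separated.
- move=> [T0 weq]; apply/(@I_weak_hausdorff_wbullet R)/I_separated_hausdorff.
  exact: I_weak_wbullet_separated.
Qed.
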